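(* Let $m\ge n\ge0$ be integers and $\alpha=m-n+\beta$. (i) Assume that $y(r)=\phi_n(r;\alpha)$ satisfies the second-order differential equation $A_n(r,\alpha)\delta_r^2y+B_n(r,\alpha)\delta_ry+C_n(r,\alpha)y=0$. Then $f=f_{m,n}(z_1,z_2;\beta)$ satisfies the second-order partial differential equations $$A_n(z_1z_2,\alpha)\delta_{z_2}^2f+B_n(z_1z_2,\alpha)\delta_{z_2}f+C_n(z_1z_2,\alpha)f=0$$ and $$A_n(z_1z_2,\alpha)\delta_{z_1}^2f+\{B_n(z_1z_2,\alpha)-2\alpha A_n(z_1z_2,\alpha)\}\delta_{z_1}f+\{\alpha^2A_n(z_1z_2,\alpha)-\alpha B_n(z_1z_2,\alpha)+C_n(z_1z_2,\alpha)\}f=0.$$ (ii) Assume that $y(r)=\phi_n(r;\alpha)$ satisfies the second-order $q$-difference equation $A_n(r,\alpha)\delta_{q,r}^2y+B_n(r,\alpha)\delta_{q,r}y+C_n(r,\alpha)y=0$. Then $f=f_{m,n}(z_1,z_2;\beta)$ satisfies the $q$-partial difference equations $$A_n(z_1z_2,\alpha)\delta_{q,z_2}^2f+B_n(z_1z_2,\alpha)\delta_{q,z_2}f+C_n(z_1z_2,\alpha)f=0$$ and $$A_n(z_1z_2,\alpha)\delta_{q,z_1}^2f+\{q^{\alpha}B_n(z_1z_2,\alpha)-2[\alpha]_qA_n(z_1z_2,\alpha)\}\delta_{q,z_1}f+\{[\alpha]_q^2A_n(z_1z_2,\alpha)-[\alpha]_qq^{\alpha}B_n(z_1z_2,\a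lpha)+q^{2\alpha}C_n(z_1z_2,\alpha)\}f=0.$$
   Context: $\phi_n(r;\alpha)$ are polynomials in $r$ of degree $n$ with real coefficients, depending on a real parameter $\alpha$ (orthogonal on $[0,\infty)$ with respect to $r^\alpha d\mu(r)$ for a positive Borel measure $\mu$ independent of $\alpha$). For $m\ge n$, $f_{m,n}(z_1,z_2;\beta)=z_1^{m-n}\phi_n(z_1z_2;m-n+\beta)$. $A_n,B_n,C_n$ are given functions of $(r,\alpha)$. The operators are $\delta_rf=r\,\partial f/\partial r$, $(D_{q,r}f)(r)=\frac{f(r)-f(qr)}{(1-q)r}$, $\delta_{q,r}f=rD_{q,r}f$, with $0<q<1$, and similarly in the variables $z_1$ and $z_2$ (acting on one variable with the other held fixed). $[a]_q=\frac{1-q^a}{1-q}$.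
   Formalization: In both z_1-equations, α as multiplier, in [α]_q and in the powers of q is replaced by m−n (the arguments of A_n, B_n, C_n stay α); as printed they fail for β≠0, e.g. m=n=0, A=C=0, B=1, φ_0 a nonzero constant. For β=0 the two forms agree. *)

(* Defs.v *)
From HB Require Import structures.
From mathcomp Require Export all_boot all_order all_algebra.
From mathcomp Require Export all_classical all_reals all_analysis.
From mathcomp Require Export complex.
Set Implicit Arguments.
Unset Strict Implicit.
Unset Printing Implicit Defensive.
Export Order.TTheory GRing.Theory Num.Theory.
Export numFieldNormedType.Exports.
Local Open Scope classical_set_scope.
Local Open Scope ring_scope.
Local Open Scope complex_scope.

Definition delta (K : numFieldType) (f : K -> K) : K -> K :=
  fun r => r * derive1 f r.

(* Since x / 0 = 0, D_q f and delta_q f vanish at r = 0; for polynomials f this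
   is also the value at 0 of the continuous extension of delta_q f. *)
Definition Dq (K : fieldType) (q : K) (f : K -> K) : K -> K :=
  fun r => (f r - f (q * r)) / ((1 - q) * r).

Definition deltaq (K : fieldType) (q : K) (f : K -> K) : K -> K :=
  fun r => r * Dq q f r.

Definition qnum (R : realType) (q a : R) : R := (1 - q `^ a) / (1 - q).

(* [J] is the set of parameters for which r^a dmu(r) is a weight.  As
   0 `^ a = 0 for a < 0, a possible atom of mu at 0 is discarded for such a. *)
Definition orthogonal_family (R : realType)
    (mu : {measure set (measurableTypeR R) -> \bar R}) (J : set R)
    (phi : nat -> R -> {poly R}) : Prop :=
  forall a : R, J a ->
  [/\ forall n, size (phi n a) = n.+1,
      forall k : nat,
        mu.-integrable `[0, +oo[ (fun r : R => (r ^+ k * r `^ a)%:E),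
      forall n m, n != m ->
        (\int[mu]_(r in `[0%R, +oo[)
           ((phi n a).[r] * (phi m a).[r] * r `^ a)%:E = 0)%E
    & forall n,
        (0 < \int[mu]_(r in `[0%R, +oo[) ((phi n a).[r] ^+ 2 * r `^ a)%:E)%E].

Definition cpoly (R : realType) (p : {poly R}) (z : R[i]) : R[i] :=
  (map_poly (real_complex R) p).[z].

(* f_{m,n}(z1, z2; beta), meant for n <= m *)
Definition fmn (R : realType) (phi : nat -> R -> {poly R}) (m n : nat)
    (beta : R) (z1 z2 : R[i]) : R[i] :=
  z1 ^+ (m - n) * cpoly (phi n ((m - n)%:R + beta)) (z1 * z2).

(* Main.v *)
Require Import Defs.
From mathcomp Require Import ring.
Set Implicit Arguments.
Unset Strict Implicit.

(** Freeze one of the two variables and call the other one [w].  Then [f_{m,n}] has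
    the form [a * w ^+ k * y (c * w)], where [y] is the polynomial
    [phi_n(.; alpha)]: for [w = z2] one has [k = 0], [c = z1] and
    [a = z1 ^+ (m - n)], while for [w = z1] one has [k = m - n], [c = z2] and
    [a = 1].  Write [D] for the operator [delta] or [delta_q].  It commutes with
    the dilation [w |-> c * w], and it obeys a Leibniz rule with respect to the
    factor [w ^+ k], so that applying it to such a function amounts to replacing
    [y] by

      [s y + t D y],   (s, t) = (k, 1) for [delta],
                       (s, t) = ([k]_q, q ^ k) for [delta_q].

    These are [delta_gauge] and [deltaq_gauge], valid also at [w = 0].

    Hence the equations for [f_{m,n}] come from substituting
    [L = s + t D] for [D]: with [D = (L - s) / t], the equation
    [A D^2 y + B D y + C y = 0] multiplied by [t ^ 2] becomes

      [A L^2 y + (t B - 2 s A) L y + (s^2 A - s t B + t^2 C) y = 0],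

    which is [gauged_equation].  The equations in [z2] are the case
    [(s, t) = (0, 1)], in which the coefficients do not change, and those in [z1]
    the case [k = m - n]. *)

Local Open Scope classical_set_scope.
Local Open Scope ring_scope.
Local Open Scope complex_scope.

(** [K] need not be totally ordered: the case of interest is the complex
    derivative, over [R[i]]. *)
Lemma is_derive_horner (K : numFieldType) (p : {poly K}) (x : K) :
  is_derive x (1 : K) (horner p) p^`().[x].
Proof.
elim/poly_ind: p => [|p c ih].
  have -> : horner (0 : {poly K}) = cst 0 by apply/funext => y; rewrite horner0.
  by rewrite deriv0 horner0; exact: is_derive_cst.
have -> : horner (p * 'X + c%:P) = horner p * id + cst c.
  by apply/funext => y; rewrite /= !hornerE.
apply: is_derive_eq.
by rewrite derivD derivM derivX derivC !hornerE /= scaler1 mulrC addrC.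
Qed.

Lemma delta_horner (K : numFieldType) (p : {poly K}) :
  delta (horner p) = horner ('X * p^`()).
Proof.
apply/funext => r; rewrite /delta derive1E hornerM hornerX.
by have D := is_derive_horner p r; rewrite derive_val.
Qed.

(** Leibniz rule for the gauge factor [w ^+ k].  The result is again a gauge
    factor times a dilated polynomial, so that the rule can be iterated.  It
    comes from the polynomial form of [delta], so it holds at [w = 0] too. *)
Lemma delta_gauge_horner (K : numFieldType) (a c : K) (k : nat) (p : {poly K}) :
  delta (fun w => a * w ^+ k * p.[c * w])
  = (fun w => a * w ^+ k * (k%:R *: p + 'X * p^`()).[c * w]).
Proof.
have -> : (fun w => a * w ^+ k * p.[c * w])
          = horner (a *: 'X^k * (p \Po (c *: 'X))).
  by apply/funext => w; rewrite !(hornerE, horner_comp).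
rewrite delta_horner; apply/funext => w.
rewrite derivM derivZ derivXn -scaler_nat deriv_comp derivZ derivX.
rewrite !(hornerE, horner_comp).
(* k = 0 is separate because of the truncated exponent k.-1 in ('X^k)^`() *)
by case: k => [|k]; rewrite ?exprS /=; ring.
Qed.

Lemma delta_gauge (K : numFieldType) (a c : K) (k : nat) (p : {poly K})
    (y := horner p) (w : K) :
  delta (fun w => a * w ^+ k * y (c * w)) w
  = a * w ^+ k * (k%:R * y (c * w) + delta y (c * w)).
Proof. by rewrite /y delta_gauge_horner delta_horner hornerD hornerZ. Qed.

Lemma delta_gauge2 (K : numFieldType) (a c : K) (k : nat) (p : {poly K})
    (y := horner p) (w : K) :
  delta (delta (fun w => a * w ^+ k * y (c * w))) w
  = a * w ^+ k * (k%:R * (k%:R * y (c * w) + delta y (c * w))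
                  + (k%:R * delta y (c * w) + delta (delta y) (c * w))).
Proof.
rewrite /y !delta_gauge_horner !delta_horner.
by rewrite derivD derivZ !(hornerD, hornerZ, hornerM, hornerX); ring.
Qed.

(** Without the quotient by [r], the formula has no exceptional point: at [r = 0]
    both sides vanish.  This is what makes the q-identities below hold for
    arbitrary functions, with no division by a variable. *)
Lemma deltaqE (K : fieldType) (q : K) (f : K -> K) (r : K) :
  deltaq q f r = (f r - f (q * r)) / (1 - q).
Proof.
rewrite /deltaq /Dq; have [->|r0] := eqVneq r 0.
  by rewrite mulr0 subrr !mul0r.
by rewrite invfM mulrCA (mulrC r) -(mulrA _ r^-1) mulVf // mulr1.
Qed.

(** The q-Leibniz rule: from [q ^+ k * y (q x) = q ^+ k * y x - q ^+ k * (y x -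
    y (q x))], the shift of the gauge factor contributes [[k]_q] and a power of [q]
    multiplying [deltaq q y].  The function [y] is arbitrary, so the rule can be
    iterated. *)
Lemma deltaq_gauge (K : fieldType) (q a c : K) (k : nat) (y : K -> K) :
  deltaq q (fun w => a * w ^+ k * y (c * w))
  = (fun w => a * w ^+ k * ((1 - q ^+ k) / (1 - q) * y (c * w)
                            + q ^+ k * deltaq q y (c * w))).
Proof.
apply/funext => w; rewrite !deltaqE exprMn (mulrCA c q w).
by ring.
Qed.

Lemma deltaq_gauge2 (K : fieldType) (q a c : K) (k : nat) (y : K -> K)
    (s := (1 - q ^+ k) / (1 - q)) (t := q ^+ k) (w : K) :
  deltaq q (deltaq q (fun w => a * w ^+ k * y (c * w))) w
  = a * w ^+ k * (s * (s * y (c * w) + t * deltaq q y (c * w))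
      + t * (s * deltaq q y (c * w) + t * deltaq q (deltaq q y) (c * w))).
Proof.
rewrite deltaq_gauge.
rewrite (deltaq_gauge q a c k (fun x => s * y x + t * deltaq q y x)).
congr (_ * (_ + _ * _)).
by rewrite !deltaqE; ring.
Qed.

(** The change of unknown operator from [D] to [L = s + t D]: the left-hand side is
    [g * t ^+ 2] times that of the equation for [D].  Here [y], [dy] and [ddy]
    stand for the values of [y], [D y] and [D^2 y] at a point, and [g] for the
    value of the gauge factor. *)
Lemma gauged_equation (K : comNzRingType) (A B C s t g y dy ddy : K) :
  A * ddy + B * dy + C * y = 0 ->
  A * (g * (s * (s * y + t * dy) + t * (s * dy + t * ddy)))
    + (t * B - 2 * s * A) * (g * (s * y + t * dy))
    + (s ^+ 2 * A - s * t * B + t ^+ 2 * C) * (g * y) = 0.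
Proof.
move=> h; transitivity (g * t ^+ 2 * (A * ddy + B * dy + C * y)); first by ring.
by rewrite h mulr0.
Qed.

Lemma delta_gauge_equation (K : numFieldType) (A B C a c : K) (k : nat)
    (p : {poly K}) (y := horner p) (f := fun w => a * w ^+ k * y (c * w)) (w : K) :
  A * delta (delta y) (c * w) + B * delta y (c * w) + C * y (c * w) = 0 ->
  A * delta (delta f) w + (B - 2 * k%:R * A) * delta f w
    + (k%:R ^+ 2 * A - k%:R * B + C) * f w = 0.
Proof.
move=> eqy; rewrite /f delta_gauge2 delta_gauge.
have := gauged_equation k%:R 1 (a * w ^+ k) eqy.
by rewrite expr1n !(mulr1, mul1r).
Qed.

(** The case [k = 0] of the previous lemma: a dilation leaves the equation
    unchanged because [delta] commutes with it. *)
Lemma delta_dilation_equation (K : numFieldType) (A B C a c : K)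
    (p : {poly K}) (y := horner p) (f := fun w => a * y (c * w)) (w : K) :
  A * delta (delta y) (c * w) + B * delta y (c * w) + C * y (c * w) = 0 ->
  A * delta (delta f) w + B * delta f w + C * f w = 0.
Proof.
have fE : f = (fun w => a * w ^+ 0 * y (c * w)).
  by apply/funext => x; rewrite expr0 mulr1.
move=> /(delta_gauge_equation a 0%N); rewrite -/y -fE.
by rewrite expr0 expr2 !(mulr0, mulr1, mul0r, oppr0, add0r, addr0).
Qed.

Lemma deltaq_gauge_equation (K : fieldType) (q A B C a c : K) (k : nat)
    (y : K -> K) (f := fun w => a * w ^+ k * y (c * w))
    (s := (1 - q ^+ k) / (1 - q)) (t := q ^+ k) (w : K) :
  A * deltaq q (deltaq q y) (c * w) + B * deltaq q y (c * w) + C * y (c * w) = 0 ->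
  A * deltaq q (deltaq q f) w + (t * B - 2 * s * A) * deltaq q f w
    + (s ^+ 2 * A - s * t * B + t ^+ 2 * C) * f w = 0.
Proof.
by move=> eqy; rewrite /f deltaq_gauge2 deltaq_gauge; exact: gauged_equation.
Qed.

Lemma deltaq_dilation_equation (K : fieldType) (q A B C a c : K)
    (y : K -> K) (f := fun w => a * y (c * w)) (w : K) :
  A * deltaq q (deltaq q y) (c * w) + B * deltaq q y (c * w) + C * y (c * w) = 0 ->
  A * deltaq q (deltaq q f) w + B * deltaq q f w + C * f w = 0.
Proof.
have fE : f = (fun w => a * w ^+ 0 * y (c * w)).
  by apply/funext => x; rewrite expr0 mulr1.
move=> /(deltaq_gauge_equation a 0%N); rewrite -fE expr0 subrr mul0r.
by rewrite expr2 expr1n !(mulr0, mulr1, mul0r, mul1r, oppr0, add0r, addr0).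
Qed.

(* In the two z1-equations the multiplier of A_n and B_n (and the exponent of q)
   is kappa = m - n, the exponent of z1 in f_{m,n}; it is equal to
   alpha = m - n + beta exactly when beta = 0.  With alpha in its place these two
   equations fail for beta <> 0. *)
Theorem theorem2p10 (R : realType)
    (mu : {measure set (measurableTypeR R) -> \bar R}) (J : set R)
    (phi : nat -> R -> {poly R}) (hphi : orthogonal_family mu J phi)
    (A B C : nat -> R[i] -> R -> R[i])
    (m n : nat) (hnm : (n <= m)%N) (beta alpha kappa : R)
    (halpha : alpha = (m - n)%:R + beta) (hkappa : kappa = (m - n)%:R)
    (hJ : J alpha) :
  ((forall r : R[i],
      A n r alpha * delta (delta (cpoly (phi n alpha))) r
      + B n r alpha * delta (cpoly (phi n alpha)) r
      + C n r alpha * cpoly (phi n alpha) r = 0) ->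
   forall z1 z2 : R[i],
     let f := fmn phi m n beta in
     let r := z1 * z2 in
     A n r alpha * delta (delta (fun w => f z1 w)) z2
       + B n r alpha * delta (fun w => f z1 w) z2
       + C n r alpha * f z1 z2 = 0
     /\
     A n r alpha * delta (delta (fun w => f w z2)) z1
       + (B n r alpha - 2 * kappa%:C * A n r alpha) * delta (fun w => f w z2) z1
       + (kappa%:C ^+ 2 * A n r alpha - kappa%:C * B n r alpha + C n r alpha)
         * f z1 z2 = 0)
  /\
  (forall q : R, 0 < q < 1 ->
   (forall r : R[i],
      A n r alpha * deltaq q%:C (deltaq q%:C (cpoly (phi n alpha))) r
      + B n r alpha * deltaq q%:C (cpoly (phi n alpha)) r
      + C n r alpha * cpoly (phi n alpha) r = 0) ->
   forall z1 z2 : R[i],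
     let f := fmn phi m n beta in
     let r := z1 * z2 in
     A n r alpha * deltaq q%:C (deltaq q%:C (fun w => f z1 w)) z2
       + B n r alpha * deltaq q%:C (fun w => f z1 w) z2
       + C n r alpha * f z1 z2 = 0
     /\
     A n r alpha * deltaq q%:C (deltaq q%:C (fun w => f w z2)) z1
       + ((q `^ kappa)%:C * B n r alpha - 2 * (qnum q kappa)%:C * A n r alpha)
         * deltaq q%:C (fun w => f w z2) z1
       + ((qnum q kappa)%:C ^+ 2 * A n r alpha
          - (qnum q kappa)%:C * (q `^ kappa)%:C * B n r alpha
          + (q `^ (2 * kappa))%:C * C n r alpha)
         * f z1 z2 = 0).
Proof.
set P := map_poly (real_complex R) (phi n alpha).
have f2E z1 : fmn phi m n beta z1 = (fun w => z1 ^+ (m - n) * P.[z1 * w]).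
  by apply/funext => w; rewrite /fmn -halpha.
have f1E z2 : (fun w => fmn phi m n beta w z2)
    = (fun w => 1 * w ^+ (m - n) * P.[z2 * w]).
  by apply/funext => w; rewrite f2E mul1r (mulrC z2).
have fE z1 z2 : fmn phi m n beta z1 z2 = 1 * z1 ^+ (m - n) * P.[z2 * z1].
  exact: (congr1 (@^~ z1) (f1E z2)).
have yE : cpoly (phi n alpha) = horner P by [].
rewrite yE; split=> [eqy z1 z2|q /andP[q0 _] eqy z1 z2] f r; split.
- by rewrite /f (f2E z1); apply: delta_dilation_equation; exact: eqy.
- rewrite /f fE (f1E z2) /r (mulrC z1) hkappa rmorph_nat.
  by apply: delta_gauge_equation; exact: eqy.
- by rewrite /f (f2E z1); apply: deltaq_dilation_equation; exact: eqy.
- have tE : (q `^ kappa)%:C = q%:C ^+ (m - n).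
    by rewrite hkappa powR_mulrn ?ltW // rmorphXn.
  have ttE : (q `^ (2 * kappa))%:C = (q%:C ^+ (m - n)) ^+ 2.
    by rewrite hkappa -natrM mulnC powR_mulrn ?ltW // rmorphXn exprM.
  have sE : (qnum q kappa)%:C = (1 - q%:C ^+ (m - n)) / (1 - q%:C).
    by rewrite /qnum fmorph_div !rmorphB !rmorph1 -tE.
  rewrite /f fE (f1E z2) /r (mulrC z1) sE tE ttE.
  by apply: deltaq_gauge_equation; exact: eqy.
Qed.
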